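(* Let $a \geq 3$ be an odd integer and let $d$ be a positive integer with $d < D_4(a)$. Then every set of equiangular lines in $\mathbb{R}^d$ with cardinality $(a^2-1)(a^2-2)/2$ and inner product $1/a$ must lie in an $(a^2-2)$-dimensional linear subspace of $\mathbb{R}^d$.
   Context: A set of lines through the origin in $\mathbb{R}^d$ is equiangular if any two distinct lines in the set form the same angle; it has inner product $\alpha\in[0,1)$ if unit vectors $c,c'$ chosen along any two distinct lines satisfy $c\cdot c'=\pm\alpha$. For an odd integer $a\ge 3$, $D_4(a)$ is the maximum (real) root of the equation $g_a(x)=0$, where $$\begin{aligned} g_a(x) ={}& (-7a^{14} - 122a^{12} - 342a^{10} + 2776a^8 + 7049a^6 - 17238a^4 - 22932a^2 - 6048)x^4 \\ &+ 12(4a^{16} + 21a^{14} - 227a^{12} - 46a^{10} + 3338a^8 - 7643a^6 + 2693a^4 + 7140a^2 + 864)x^3 \\ &-9a^2(11a^{16} - 94a^{14} - 25a^{12} + 3068a^{10} - 13951a^8 + 25882a^6 - 15987a^4 - 9608a^2 + 14800)x^2 \\ &+ 54a^2(a-2)^2(a-1)^2(a+1)^2(a+2)^2(a^2+1)(a^4 - a^3 - 5a^2 + 3a + 10)(a^4 + a^3 - 5a^2 - 3a + 10)x \\ &-81a^2(a - 2)^4(a - 1)^4(a + 1)^4(a + 2)^4. \end{aligned}$$ *)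

(* Defs.v *)
From mathcomp Require Import all_boot all_order all_algebra.
From mathcomp Require Import finmap.
From mathcomp Require Import reals trigo.

Set Implicit Arguments.
Unset Strict Implicit.
Unset Printing Implicit Defensive.

Import Order.TTheory GRing.Theory Num.Theory.

Local Open Scope fset_scope.
Local Open Scope ring_scope.

Definition dot (R : realType) (d : nat) (u v : 'rV[R]_d) : R :=
  \sum_(i < d) u 0 i * v 0 i.

Definition unit_vector (R : realType) (d : nat) (u : 'rV[R]_d) : Prop :=
  dot u u = 1.

Definition is_line (R : realType) (d : nat) (l : {vspace 'rV[R]_d}) : Prop :=
  \dim l = 1%N.

(* The angle between two lines is the non-obtuse one, hence the absolute
   value; it does not depend on the unit vectors c and c'. *)
Definition forms_angle (R : realType) (d : nat) (l l' : {vspace 'rV[R]_d})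
    (theta : R) : Prop :=
  forall c c' : 'rV[R]_d, c \in l -> c' \in l' ->
    unit_vector c -> unit_vector c' -> acos `|dot c c'| = theta.

Definition equiangular (R : realType) (d : nat)
    (L : {fset {vspace 'rV[R]_d}}) : Prop :=
  (forall l, l \in L -> is_line l) /\
  exists theta : R, forall l l', l \in L -> l' \in L -> l != l' ->
    forms_angle l l' theta.

Definition has_inner_product (R : realType) (d : nat)
    (L : {fset {vspace 'rV[R]_d}}) (alpha : R) : Prop :=
  forall l l', l \in L -> l' \in L -> l != l' ->
    forall c c' : 'rV[R]_d, c \in l -> c' \in l' ->
      unit_vector c -> unit_vector c' ->
      dot c c' = alpha \/ dot c c' = - alpha.

(* The constants above 5000 carry an explicit %:R, so that they are parsed as
   abbreviated decimals rather than as unary natural numbers. *)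
Definition g (R : realType) (a : R) : {poly R} :=
    (- 7 * a ^+ 14 - 122 * a ^+ 12 - 342 * a ^+ 10 + 2776 * a ^+ 8
     + 7049%:R * a ^+ 6 - 17238%:R * a ^+ 4 - 22932%:R * a ^+ 2 - 6048%:R) *: 'X^4
  + (12 * (4 * a ^+ 16 + 21 * a ^+ 14 - 227 * a ^+ 12 - 46 * a ^+ 10
           + 3338 * a ^+ 8 - 7643%:R * a ^+ 6 + 2693 * a ^+ 4 + 7140%:R * a ^+ 2
           + 864)) *: 'X^3
  - (9 * a ^+ 2 * (11 * a ^+ 16 - 94 * a ^+ 14 - 25 * a ^+ 12
                   + 3068 * a ^+ 10 - 13951%:R * a ^+ 8 + 25882%:R * a ^+ 6
                   - 15987%:R * a ^+ 4 - 9608%:R * a ^+ 2 + 14800%:R)) *: 'X^2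
  + (54 * a ^+ 2 * (a - 2) ^+ 2 * (a - 1) ^+ 2 * (a + 1) ^+ 2 * (a + 2) ^+ 2
     * (a ^+ 2 + 1) * (a ^+ 4 - a ^+ 3 - 5 * a ^+ 2 + 3 * a + 10)
     * (a ^+ 4 + a ^+ 3 - 5 * a ^+ 2 - 3 * a + 10)) *: 'X
  - (81 * a ^+ 2 * (a - 2) ^+ 4 * (a - 1) ^+ 4 * (a + 1) ^+ 4
     * (a + 2) ^+ 4)%:P.

Definition is_max_root (R : realType) (p : {poly R}) (x : R) : Prop :=
  root p x /\ forall y : R, root p y -> y <= x.

Definition is_D4 (R : realType) (a : nat) (D : R) : Prop :=
  is_max_root (g a%:R) D.

(* Main.v *)
Require Import Defs.
From mathcomp Require Import all_boot all_order all_algebra.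
From mathcomp Require Import finmap.
From mathcomp Require Import reals trigo.
From mathcomp Require Import ring lra.

Set Implicit Arguments.
Unset Strict Implicit.
Unset Printing Implicit Defensive.

Import Order.TTheory GRing.Theory Num.Theory.

Local Open Scope fset_scope.
Local Open Scope ring_scope.

(** Choose a unit vector [v_i] on each of the [N] lines, put [alpha = 1/a], and
    let [G = 1 + alpha S] be the Gram matrix, so that [S] has zero diagonal and
    entries 1 and -1 elsewhere.  Write [mu = (a^2 - 1)/2]; the trace of [G^2] is
    [N mu].  If [G^2 = mu G], then the frame operator [sum_i v_i^T v_i] acts as
    [mu] on the span of the lines, and comparing traces gives the span dimension
    [N / mu = a^2 - 2].  It therefore suffices to prove
    [tr G^3 <= N mu^2] (lemma [tight_frame]): the squared norm of
    [G V - mu V], where [V] has the [v_i] as rows, is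
    [tr G^3 - 2 mu tr G^2 + mu^2 tr G = tr G^3 - N mu^2].

    The trace of [G^3] counts triangles: call [ijk] even or odd according to the
    sign of [S_ij S_jk S_ki].  With [p_ij] the number of even triangles on the
    edge [ij], what is needed is that the average of the [p_ij] is at most
    [p0 = (N - 1 - a)(a + 1)/(2a)].

    Fix an edge [ij] and project the lines [k] for which [ijk] is even on the
    orthogonal complement of [v_i] and [v_j], a space of dimension [d - 2].  All
    the projections have the same norm, and two of them have one of two inner
    products, decided by the parity of the triangle [ikl].  The cubic kernel
    [(u.v)^3 - 3/d |u|^2 |v|^2 (u.v)] is positive semidefinite in dimension
    [d - 2] ([cubic_kernel_ge0]); this is the Gegenbauer polynomial of degree
    three.  Its sum over the chosen lines is thus nonnegative, which is an
    inequality between [p_ij], [p_ij^2] and the number of pairs [k, l] with [ijk],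
    [ijl] even and [ikl] odd ([cubic_edge_ineq]).  Summed over all edges, the
    last number is determined by the others, because a quadruple has an even number
    of odd triangles: it is half the sum of [p_ij (N - 2 - p_ij)]
    ([even_odd_count]).  What remains for [N = (a^2 - 1)(a^2 - 2)/2] is
    [B (sum p_ij^2 - p0 sum p_ij) >= 0], where [B] has the sign of
    [(a^3 + 9a + 6) d - 3a (a - 1)^2 (a + 2)^2].  When [B < 0] this reads
    [sum p_ij^2 <= p0 sum p_ij], and the inequality of Cauchy and Schwarz bounds
    the average of the [p_ij] by [p0].

    That [B] is negative for [d] below the largest root of [g a] follows from an
    identity ([horner_g]): [g a] is minus a square minus a product of linear
    factors which are all positive to the right of
    [3a (a - 1)^2 (a + 2)^2 / (a^3 + 9a + 6)]; hence [g a] has no root there. *)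

(** * The largest root of the quartic *)

Lemma horner_quartic (R : comNzRingType) (c0 c1 c2 c3 c4 x : R) :
  (c4 *: 'X^4 + c3 *: 'X^3 - c2 *: 'X^2 + c1 *: 'X - c0%:P).[x] =
  c4 * x ^+ 4 + c3 * x ^+ 3 - c2 * x ^+ 2 + c1 * x - c0.
Proof. by rewrite !hornerE. Qed.

(** The two factors in the middle are exchanged by [a |-> - a], up to sign, under
    which [g] is invariant.  At their roots and at 0, [- g a] takes square
    values, whose square roots, with suitable signs, determine by interpolation
    the quadratic polynomial being squared. *)
Lemma horner_g (R : realType) (a x : R) :
  (g a).[x] =
  - (a * (9 * (a ^+ 2 - 1) ^+ 2 * (a ^+ 2 - 4) ^+ 2
          - 3 * (a ^+ 8 - 11 * a ^+ 6 + 63 * a ^+ 4 - 137 * a ^+ 2 + 148) * x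
          + (a ^+ 6 + 4 * a ^+ 4 - 35 * a ^+ 2 + 222) * x ^+ 2)) ^+ 2
  - 6 * (a ^+ 2 - 1) ^+ 2 * (a ^+ 2 - 4) * x
    * ((a ^+ 3 + 9 * a + 6) * x - 3 * a * ((a - 1) * (a + 2)) ^+ 2)
    * ((a ^+ 3 + 9 * a - 6) * x - 3 * a * ((a + 1) * (a - 2)) ^+ 2)
    * ((a ^+ 2 + 7) * x - (a ^+ 4 - 5 * a ^+ 2 + 12)).
Proof.
by rewrite /g horner_quartic; ring.
Qed.

Lemma D4_le (R : realType) (a x : R) : 3 <= a -> root (g a) x ->
  (a ^+ 3 + 9 * a + 6) * x <= 3 * a * ((a - 1) * (a + 2)) ^+ 2.
Proof.
move=> a_ge3 /rootP; rewrite horner_g => gx0; rewrite leNgt; apply/negP => Tx.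
(* In powers of [b], the polynomials which have to be positive for [a >= 3] have
   positive coefficients. *)
have [b b0 aE] : exists2 b, 0 <= b & a = 3 + b.
  by exists (a - 3); rewrite ?subr_ge0 // addrC subrK.
set K := a ^+ 3 + 9 * a + 6 in Tx gx0.
set K' := a ^+ 3 + 9 * a - 6 in gx0.
set W := ((a - 1) * (a + 2)) ^+ 2 in Tx gx0.
set W' := ((a + 1) * (a - 2)) ^+ 2 in gx0.
have K0 : 0 < K.
  have -> : K = b ^+ 3 + 9 * b ^+ 2 + 36 * b + 60 by rewrite /K aE; ring.
  by rewrite ltr_wpDl // !addr_ge0 ?mulr_ge0 ?exprn_ge0 ?ler0n ?ltr0n.
have K'0 : 0 < K'.
  have -> : K' = b ^+ 3 + 9 * b ^+ 2 + 36 * b + 48 by rewrite /K' aE; ring.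
  by rewrite ltr_wpDl // !addr_ge0 ?mulr_ge0 ?exprn_ge0 ?ler0n ?ltr0n.
have KW : K * W' < K' * W.
  rewrite -subr_gt0.
  have -> : K' * W - K * W' = 4 * b ^+ 6 + 72 * b ^+ 5 + 556 * b ^+ 4
      + 2352%:R * b ^+ 3 + 5688%:R * b ^+ 2 + 7344%:R * b + 3840%:R.
    by rewrite /K /K' /W /W' aE; ring.
  by rewrite ltr_wpDl // !addr_ge0 ?mulr_ge0 ?exprn_ge0 ?ler0n ?ltr0n.
have KL : K * (a ^+ 4 - 5 * a ^+ 2 + 12) < 3 * a * W * (a ^+ 2 + 7).
  rewrite -subr_gt0.
  have -> : 3 * a * W * (a ^+ 2 + 7) - K * (a ^+ 4 - 5 * a ^+ 2 + 12)
      = 2 * b ^+ 7 + 48 * b ^+ 6 + 494 * b ^+ 5 + 2844%:R * b ^+ 4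
      + 9900%:R * b ^+ 3 + 20736%:R * b ^+ 2 + 23952%:R * b + 11520%:R.
    by rewrite /K /W aE; ring.
  by rewrite ltr_wpDl // !addr_ge0 ?mulr_ge0 ?exprn_ge0 ?ler0n ?ltr0n.
have a0 : 0 < a by lra.
have a2 : 9 <= a ^+ 2 by nra.
have W0 : 0 <= W by rewrite /W exprn_even_ge0.
have x0 : 0 < x.
  rewrite -(pmulr_rgt0 _ K0); apply: le_lt_trans Tx.
  by apply: mulr_ge0 => //; apply: mulr_ge0 => //; apply: ltW.
have F1 : 0 < K * x - 3 * a * W by rewrite subr_gt0.
have F2 : 0 < K' * x - 3 * a * W'.
  rewrite -(pmulr_rgt0 _ K0) mulrBr subr_gt0.
  rewrite [ltLHS](_ : _ = 3 * a * (K * W')); last by ring.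
  rewrite [ltRHS](_ : _ = K' * (K * x)); last by ring.
  apply: (@lt_trans _ _ (3 * a * (K' * W))).
    by rewrite ltr_pM2l // mulr_gt0.
  by rewrite [ltLHS](_ : _ = K' * (3 * a * W)) ?ltr_pM2l //; ring.
have F3 : 0 < (a ^+ 2 + 7) * x - (a ^+ 4 - 5 * a ^+ 2 + 12).
  rewrite -(pmulr_rgt0 _ K0) mulrBr subr_gt0.
  apply: (lt_trans KL).
  by rewrite [ltRHS]mulrCA [ltLHS]mulrC ltr_pM2l //; lra.
have F0 : 0 < 6 * (a ^+ 2 - 1) ^+ 2 * (a ^+ 2 - 4) * x.
  by rewrite !mulr_gt0 ?exprn_gt0 // subr_gt0; lra.
have := mulr_gt0 (mulr_gt0 (mulr_gt0 F0 F1) F2) F3.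
move: gx0 => /eqP; rewrite subr_eq add0r eqr_oppLR => /eqP gx0.
have := sqr_ge0 (a * (9 * (a ^+ 2 - 1) ^+ 2 * (a ^+ 2 - 4) ^+ 2
          - 3 * (a ^+ 8 - 11 * a ^+ 6 + 63 * a ^+ 4 - 137 * a ^+ 2 + 148) * x
          + (a ^+ 6 + 4 * a ^+ 4 - 35 * a ^+ 2 + 222) * x ^+ 2)).
by rewrite gx0 oppr_ge0 => /le_lt_trans h /h; rewrite ltxx.
Qed.

(** * Parity of triangles in a signed complete graph *)

(** Seidel matrices of signed complete graphs. *)
Definition signing (R : pzRingType) (I : finType) (s : I -> I -> R) : Prop :=
  (forall i j, s i j = s j i) /\
  (forall i j, s i j ^+ 2 = (i != j)%:R).

Definition tri (R : pzRingType) (I : finType) (s : I -> I -> R) (i j k : I) : R :=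
  s i j * s j k * s k i.

Definition even_tri (R : fieldType) (I : finType) (s : I -> I -> R) (i j k : I) : R :=
  (tri s i j k ^+ 2 + tri s i j k) / 2.

Definition odd_tri (R : fieldType) (I : finType) (s : I -> I -> R) (i j k : I) : R :=
  (tri s i j k ^+ 2 - tri s i j k) / 2.

Section TwoGraph.
Variables (R : realFieldType) (I : finType) (s : I -> I -> R).
Hypothesis sS : signing s.

Let sC i j : s i j = s j i. Proof. exact: sS.1. Qed.
Let s_sqr i j : s i j ^+ 2 = (i != j)%:R. Proof. exact: sS.2. Qed.

Lemma signing_diag i : s i i = 0.
Proof. by apply/eqP; rewrite -sqrf_eq0 s_sqr eqxx. Qed.

Lemma tri_sqr i j k : tri s i j k ^+ 2 = ((i != j) && (j != k) && (k != i))%:R.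
Proof. by rewrite /tri !exprMn !s_sqr -!natrM !mulnb. Qed.

Lemma triCA i j k : tri s j i k = tri s i j k.
Proof. by rewrite /tri (sC j i) (sC i k) (sC k j); ring. Qed.

Lemma triAC i j k : tri s i k j = tri s i j k.
Proof. by rewrite /tri (sC i k) (sC k j) (sC j i); ring. Qed.

Variant tri_spec (i j k : I) : R -> bool -> Prop :=
| TriDegenerate : tri_spec i j k 0 false
| TriEven : tri_spec i j k 1 true
| TriOdd : tri_spec i j k (- 1) true.

Lemma triP i j k :
  tri_spec i j k (tri s i j k) ((i != j) && (j != k) && (k != i)).
Proof.
have := tri_sqr i j k; case: (_ && _) => /eqP.
  by rewrite sqrf_eq1 => /orP[] /eqP ->; constructor.
by rewrite sqrf_eq0 => /eqP ->; constructor.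
Qed.

Lemma even_tri_idem i j k : even_tri s i j k ^+ 2 = even_tri s i j k.
Proof. by rewrite /even_tri; case: triP => /=; field. Qed.

Lemma even_odd_tri0 i j k : even_tri s i j k * odd_tri s i j k = 0.
Proof. by rewrite /even_tri /odd_tri; case: triP => /=; field. Qed.

Lemma even_odd_tri1 i j k :
  even_tri s i j k + odd_tri s i j k = ((i != j) && (j != k) && (k != i))%:R.
Proof. by rewrite -tri_sqr /even_tri /odd_tri; field. Qed.

(** A quadruple has an even number of odd triangles: in the product of the four
    triangles each edge occurs twice. *)
Lemma tri_K4 i j k l : i != j -> i != k -> i != l ->
  tri s j k l = tri s i j k * tri s i j l * tri s i k l.
Proof.
move=> ij ik il; rewrite -[LHS]mul1r.
have <- : s i j ^+ 2 * s i k ^+ 2 * s i l ^+ 2 = 1 by rewrite !s_sqr ij ik il !mulr1.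
by rewrite /tri (sC k i) (sC l i) (sC l j) (sC k l); ring.
Qed.

(** If [ijk] is even and [ijl] is odd, then exactly one of [ikl] and [jkl] is
    even; the second summand is the first with [i] and [j] exchanged. *)
Lemma K4_split i j k l :
  even_tri s i j k * odd_tri s i j l =
  even_tri s i j k * odd_tri s i j l * even_tri s i k l
  + even_tri s j i k * odd_tri s j i l * even_tri s j k l.
Proof.
have [<-|kl] := eqVneq k l; first by rewrite !even_odd_tri0 !mul0r addr0.
rewrite /even_tri /odd_tri !(triCA i j).
have [dijk|/negbTE dijk] := boolP ((i != j) && (j != k) && (k != i)); last first.
  by case: triP dijk => // _; field.
have [dijl|/negbTE dijl] := boolP ((i != j) && (j != l) && (l != i)); last first.
  by case: (triP i j l) dijl => // _; field.
have /andP[/andP[ij _] ki] := dijk; have /andP[_ li] := dijl.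
have [ik il] : i != k /\ i != l by rewrite eq_sym ki eq_sym li.
rewrite (tri_K4 ij ik il).
have : (i != k) && (k != l) && (l != i) by rewrite eq_sym ki kl li.
by case: (triP i k l) => // _; case: (triP i j k) dijk => // _;
  case: (triP i j l) dijl => // _; field.
Qed.

(** By [K4_split] and the symmetry between [i] and [j], the left-hand side is twice
    the number of quadruples with [ijk] and [ikl] even and [ijl] odd.  Exchanging
    [j] and [k] turns these into the quadruples on the right. *)
Lemma even_odd_count :
  \sum_i \sum_j \sum_k \sum_l even_tri s i j k * odd_tri s i j l
  = 2 * \sum_i \sum_j \sum_k \sum_l
      even_tri s i j k * even_tri s i j l * odd_tri s i k l.
Proof.
under eq_bigr do under eq_bigr do under eq_bigr do under eq_bigr do rewrite K4_split.
under eq_bigr do under eq_bigr do under eq_bigr do rewrite big_split /=.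
under eq_bigr do under eq_bigr do rewrite big_split /=.
under eq_bigr do rewrite big_split /=.
rewrite big_split /= [X in _ + X]exchange_big /= -[LHS]mulr2n -[LHS]mulr_natl; congr (_ * _).
apply: eq_bigr => i _; rewrite exchange_big; apply: eq_bigr => j _.
apply: eq_bigr => k _; apply: eq_bigr => l _.
by rewrite /even_tri /odd_tri !(triAC i k j); ring.
Qed.

End TwoGraph.

(** * Positivity of the cubic kernel *)

Lemma sum_sqr (R : comPzRingType) (J : finType) (F : J -> R) :
  (\sum_j F j) ^+ 2 = \sum_j \sum_k F j * F k.
Proof.
by rewrite expr2 mulr_suml; apply: eq_bigr => j _; rewrite mulr_sumr.
Qed.

Lemma sum3_mul (R : comPzRingType) (J : finType) (F G H : J -> R) :
  \sum_a \sum_b \sum_e F a * G b * H e = (\sum_a F a) * (\sum_b G b) * (\sum_e H e).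
Proof.
rewrite -mulrA mulr_suml; apply: eq_bigr => a _.
rewrite mulr_suml mulr_sumr; apply: eq_bigr => b _.
by rewrite mulrA mulr_sumr.
Qed.

(** Here [Pi] is the orthogonal projection on a space of dimension [n] containing
    the vectors [z k].  Let [T] be the sum of the [c k] times the tensor cubes of
    the [z k], and [tau] its contraction.  The sum is the squared norm of the
    traceless part of [T], that is of [T - X / (n + 2)] with [X] the
    symmetrization of [Pi] tensor [tau], once [<T, X> = 3 |tau|^2] and
    [<X, X> = 3 (n + 2) |tau|^2] are known. *)
Lemma cubic_kernel_ge0 (R : realFieldType) (J K : finType)
    (Pi : J -> J -> R) (n : R) (z : K -> J -> R) (c : K -> R)
    (ip : K -> K -> R) :
  (forall a b, Pi a b = Pi b a) ->
  (forall a e, \sum_b Pi a b * Pi b e = Pi a e) ->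
  \sum_a Pi a a = n -> 0 < n + 2 ->
  (forall k a, \sum_b Pi a b * z k b = z k a) ->
  (forall k l, ip k l = \sum_a z k a * z l a) ->
  0 <= \sum_k \sum_l c k * c l *
         (ip k l ^+ 3 - 3 / (n + 2) * (ip k k * ip l l * ip k l)).
Proof.
move=> Pisym Pi2 PiT n0 Piz ipE.
pose tau e := \sum_k c k * ip k k * z k e.
pose T a b e := \sum_k c k * (z k a * z k b * z k e).
pose X a b e := Pi a b * tau e + Pi b e * tau a + Pi a e * tau b.
pose th := \sum_e tau e ^+ 2.
have thE : th = \sum_k \sum_l c k * c l * (ip k k * ip l l * ip k l).
  rewrite /th.
  under eq_bigr do rewrite sum_sqr.
  rewrite exchange_big; apply: eq_bigr => k _.
  rewrite exchange_big; apply: eq_bigr => l _.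
  by rewrite (ipE k l) !mulr_sumr; apply: eq_bigr => a _; ring.
have Pitau a : \sum_b Pi a b * tau b = tau a.
  rewrite /tau.
  under eq_bigr do rewrite mulr_sumr.
  rewrite exchange_big; apply: eq_bigr => k _.
  by rewrite -Piz mulr_sumr; apply: eq_bigr => b _; ring.
have TTE : \sum_a \sum_b \sum_e T a b e ^+ 2
         = \sum_k \sum_l c k * c l * ip k l ^+ 3.
  under eq_bigr do under eq_bigr do under eq_bigr do rewrite sum_sqr.
  under eq_bigr do under eq_bigr do rewrite exchange_big.
  under eq_bigr do rewrite exchange_big.
  rewrite exchange_big; apply: eq_bigr => k _ /=.
  under eq_bigr do under eq_bigr do rewrite exchange_big.
  under eq_bigr do rewrite exchange_big.
  rewrite exchange_big; apply: eq_bigr => l _ /=.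
  rewrite [_ ^+ 3](_ : _ = ip k l * ip k l * ip k l); last by ring.
  rewrite !ipE -sum3_mul mulr_sumr; apply: eq_bigr => a _.
  rewrite mulr_sumr; apply: eq_bigr => b _.
  by rewrite mulr_sumr; apply: eq_bigr => e _; ring.
have sumT W : \sum_a \sum_b \sum_e T a b e * W a b e
    = \sum_k c k * \sum_a \sum_b \sum_e z k a * z k b * z k e * W a b e.
  under eq_bigr do under eq_bigr do under eq_bigr do rewrite mulr_suml.
  under eq_bigr do under eq_bigr do rewrite exchange_big.
  under eq_bigr do rewrite exchange_big.
  rewrite exchange_big; apply: eq_bigr => k _ /=.
  rewrite mulr_sumr; apply: eq_bigr => a _.
  rewrite mulr_sumr; apply: eq_bigr => b _.
  by rewrite mulr_sumr; apply: eq_bigr => e _; ring.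
have TP1 : \sum_a \sum_b \sum_e T a b e * (Pi a b * tau e) = th.
  rewrite sumT /th.
  under [RHS]eq_bigr do rewrite expr2 mulr_suml.
  rewrite exchange_big /=; apply: eq_bigr => k _.
  rewrite ipE.
  transitivity (c k * ((\sum_a z k a * \sum_b Pi a b * z k b) * \sum_e z k e * tau e)).
    congr (_ * _); rewrite mulr_suml; apply: eq_bigr => a _.
    rewrite -mulrA mulr_suml mulr_sumr; apply: eq_bigr => b _.
    by rewrite !mulr_sumr; apply: eq_bigr => e _; ring.
  under [X in _ * (X * _)]eq_bigr do rewrite Piz.
  by rewrite mulrA mulr_sumr; apply: eq_bigr => e _; ring.
have TXE : \sum_a \sum_b \sum_e T a b e * X a b e = 3 * th.
  rewrite /X.
  under eq_bigr do under eq_bigr do under eq_bigr do rewrite !mulrDr.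
  under eq_bigr do under eq_bigr do rewrite !big_split /=.
  under eq_bigr do rewrite !big_split /=.
  rewrite !big_split /= TP1.
  rewrite [X in _ + X + _ = _](_ : _ = th); last first.
    rewrite -TP1 exchange_big; under eq_bigr do rewrite exchange_big.
    apply: eq_bigr => a _; apply: eq_bigr => b _; apply: eq_bigr => e _ /=.
    by rewrite /T; congr (_ * _); apply: eq_bigr => k _; ring.
  rewrite [X in _ + _ + X = _](_ : _ = th); first by ring.
  rewrite -TP1; under eq_bigr do rewrite exchange_big.
  apply: eq_bigr => a _; apply: eq_bigr => b _; apply: eq_bigr => e _ /=.
  by rewrite /T; congr (_ * _); apply: eq_bigr => k _; ring.
have sumX3 (F G H : J -> J -> J -> R) :
    \sum_a \sum_b \sum_e (F a b e + G a b e + H a b e) =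
    \sum_a \sum_b \sum_e F a b e + \sum_a \sum_b \sum_e G a b e
    + \sum_a \sum_b \sum_e H a b e.
  under eq_bigr do under eq_bigr do rewrite !big_split /=.
  under eq_bigr do rewrite !big_split /=.
  by rewrite !big_split.
have PX : \sum_a \sum_b \sum_e Pi a b * tau e * X a b e = (n + 2) * th.
  rewrite /X.
  under eq_bigr do under eq_bigr do under eq_bigr do rewrite !mulrDr.
  rewrite sumX3.
  rewrite [X in X + _ + _](_ : _ = n * th); last first.
    rewrite -PiT mulr_suml; apply: eq_bigr => a _.
    rewrite -(Pi2 a a) mulr_suml; apply: eq_bigr => b _.
    by rewrite mulr_sumr; apply: eq_bigr => e _; rewrite (Pisym b a); ring.
  rewrite [X in _ + X + _](_ : _ = th); last first.
    apply: eq_bigr => a _; rewrite exchange_big /= expr2.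
    rewrite [RHS](_ : _ = (\sum_e Pi a e * tau e) * tau a); last by rewrite Pitau.
    rewrite mulr_suml.
    apply: eq_bigr => e _; rewrite -(Pi2 a e) !mulr_suml.
    by apply: eq_bigr => b _; ring.
  rewrite [X in _ + _ + X](_ : _ = th); first by ring.
  rewrite exchange_big /=; apply: eq_bigr => b _.
  rewrite exchange_big /= expr2.
  rewrite [RHS](_ : _ = (\sum_e Pi b e * tau e) * tau b); last by rewrite Pitau.
  rewrite mulr_suml.
  apply: eq_bigr => e _; rewrite -(Pi2 b e) !mulr_suml.
  by apply: eq_bigr => a _; rewrite (Pisym a b); ring.
have XXE : \sum_a \sum_b \sum_e X a b e * X a b e = 3 * ((n + 2) * th).
  rewrite {1}/X.
  under eq_bigr do under eq_bigr do under eq_bigr do rewrite !mulrDl.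
  rewrite sumX3 PX.
  rewrite [X in _ + X + _ = _](_ : _ = (n + 2) * th); last first.
    rewrite -PX exchange_big; under eq_bigr do rewrite exchange_big.
    apply: eq_bigr => a _; apply: eq_bigr => b _; apply: eq_bigr => e _ /=.
    by rewrite /X (Pisym e a) (Pisym e b); ring.
  rewrite [X in _ + _ + X = _](_ : _ = (n + 2) * th); first by ring.
  rewrite -PX; under eq_bigr do rewrite exchange_big.
  apply: eq_bigr => a _; apply: eq_bigr => b _; apply: eq_bigr => e _ /=.
  by rewrite /X (Pisym e b); ring.
pose kap := (n + 2)^-1.
have sq_ge0 : 0 <= \sum_a \sum_b \sum_e (T a b e - kap * X a b e) ^+ 2.
  by do 3 (apply: sumr_ge0 => ? _); rewrite sqr_ge0.
have sqE : \sum_a \sum_b \sum_e (T a b e - kap * X a b e) ^+ 2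
   = \sum_k \sum_l c k * c l * ip k l ^+ 3 - 3 / (n + 2) * th.
  transitivity (\sum_a \sum_b \sum_e T a b e ^+ 2
     - 2 * kap * (3 * th) + kap ^+ 2 * (3 * ((n + 2) * th))); last first.
    by rewrite TTE /kap; field; rewrite gt_eqF.
  rewrite -TXE -XXE !mulr_sumr -sumrN -!big_split; apply: eq_bigr => a _ /=.
  rewrite !mulr_sumr -sumrN -!big_split; apply: eq_bigr => b _ /=.
  by rewrite !mulr_sumr -sumrN -!big_split; apply: eq_bigr => e _ /=; ring.
move: sq_ge0; rewrite sqE thE => /le_trans; apply.
rewrite mulr_sumr -sumrB; apply: ler_sum => k _.
rewrite mulr_sumr -sumrB; apply: ler_sum => l _.
by rewrite le_eqVlt; apply/orP; left; apply/eqP; ring.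
Qed.

(** * Projection on the complement of two vectors *)

(** For unit vectors [u] and [v] with inner product [t]: the orthogonal projection
    on the complement of their span, written with the inverse of their 2 by 2
    Gram matrix. *)
Definition compl_proj (R : fieldType) (d : nat) (u v : 'rV[R]_d) (t : R) : 'M[R]_d :=
  1%:M - (1 - t ^+ 2)^-1 *: (u^T *m u + v^T *m v - t *: (u^T *m v + v^T *m u)).

Section ComplProj.
Variables (R : fieldType) (d : nat) (u v : 'rV[R]_d) (t : R).
Hypotheses (uu : u *m u^T = 1%:M) (vv : v *m v^T = 1%:M) (uv : u *m v^T = t%:M).
Hypothesis t1 : 1 - t ^+ 2 != 0.

Let vu : v *m u^T = t%:M.
Proof. by rewrite -[LHS]trmxK trmx_mul trmxK uv tr_scalar_mx. Qed.

Lemma compl_proj_sym : (compl_proj u v t)^T = compl_proj u v t.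
Proof.
by apply/matrixP => a b; rewrite !mxE !big_ord1 !mxE eq_sym; ring.
Qed.

Lemma mul_compl_proj_left : u *m compl_proj u v t = 0.
Proof.
rewrite /compl_proj mulmxBr mulmx1 -scalemxAr mulmxBr mulmxDr -scalemxAr mulmxDr.
rewrite !mulmxA uu uv !mul1mx !mul_scalar_mx.
apply/eqP; rewrite subr_eq0; apply/eqP/rowP => i; rewrite !mxE.
by field.
Qed.

Lemma mul_compl_proj_right : v *m compl_proj u v t = 0.
Proof.
rewrite /compl_proj mulmxBr mulmx1 -scalemxAr mulmxBr mulmxDr -scalemxAr mulmxDr.
rewrite !mulmxA vu vv !mul1mx !mul_scalar_mx.
apply/eqP; rewrite subr_eq0; apply/eqP/rowP => i; rewrite !mxE.
by field.
Qed.

Lemma compl_proj_idem : compl_proj u v t *m compl_proj u v t = compl_proj u v t.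
Proof.
rewrite {1}/compl_proj mulmxBl mul1mx -scalemxAl mulmxBl mulmxDl -scalemxAl mulmxDl.
by rewrite -!mulmxA mul_compl_proj_left mul_compl_proj_right !mulmx0 !addr0 !(scaler0, subr0).
Qed.

Lemma mxtrace_compl_proj : \tr (compl_proj u v t) = d%:R - 2.
Proof.
rewrite /compl_proj raddfB /= mxtraceZ raddfB /= mxtraceZ !mxtraceD mxtrace1.
rewrite !(mxtrace_mulC _^T) uu vv uv vu !mxtrace_scalar.
by field.
Qed.

End ComplProj.

(** * The cubic inequality on an edge and its sum *)

Section Averaging.
Variables (R : realFieldType) (N : nat) (s : 'I_N -> 'I_N -> R).
Hypothesis sS : signing s.

Definition even_deg (i j : 'I_N) : R := \sum_k even_tri s i j k.

Definition mixed_deg (i j : 'I_N) : R :=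
  \sum_k \sum_l even_tri s i j k * even_tri s i j l * odd_tri s i k l.

Lemma even_tri_diag i k : even_tri s i i k = 0.
Proof. by rewrite /even_tri /tri (signing_diag sS); field. Qed.

Lemma even_deg_diag i : even_deg i i = 0.
Proof. by rewrite /even_deg big1 // => k _; apply: even_tri_diag. Qed.

Lemma mixed_deg_diag i : mixed_deg i i = 0.
Proof.
by rewrite /mixed_deg big1 // => k _; rewrite big1 // => l _; rewrite even_tri_diag !mul0r.
Qed.

Lemma sum_delta (i : 'I_N) (F : 'I_N -> R) : \sum_k (k == i)%:R * F k = F i.
Proof.
rewrite (bigD1 i) //= eqxx mul1r big1 ?addr0 // => k /negbTE ->.
by rewrite mul0r.
Qed.

Lemma sum_odd_tri i j : i != j ->
  \sum_k odd_tri s i j k = N%:R - 2 - even_deg i j.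
Proof.
move=> ij; apply/eqP; rewrite -subr_eq0 opprB addrA subr_eq0; apply/eqP.
rewrite /even_deg addrC -big_split /=.
transitivity (\sum_(k < N) (1 - (k == i)%:R * 1 - (k == j)%:R * 1) : R).
  apply: eq_bigr => k _; rewrite (even_odd_tri1 sS) ij /= !mulr1 (eq_sym j).
  case: eqVneq => [->|_]; case: eqVneq => [ki|_] /=; rewrite ?subr0 ?subrr //.
  by rewrite ki eqxx in ij.
rewrite !sumrB !sum_delta sumr_const card_ord; ring.
Qed.

(** [even_odd_count] expresses the sum of [mixed_deg] through the first two moments
    of [even_deg], so that only these remain after summation over the edges. *)
Lemma sum_cubic_edge_ineq (h0 h1 h2 : R) :
  (forall i j, i != j ->
    0 <= h0 * even_deg i j + h1 * (even_deg i j ^+ 2 - even_deg i j)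
         - (h1 - h2) * mixed_deg i j) ->
  0 <= (h0 - h1 - (h1 - h2) / 2 * (N%:R - 2)) * \sum_i \sum_j even_deg i j
       + (3 * h1 - h2) / 2 * \sum_i \sum_j even_deg i j ^+ 2.
Proof.
move=> H.
have mixE : \sum_i \sum_j even_deg i j * (N%:R - 2 - even_deg i j)
   = 2 * \sum_i \sum_j mixed_deg i j.
  rewrite /mixed_deg -(even_odd_count sS); apply: eq_bigr => i _; apply: eq_bigr => j _.
  have [->|ij] := eqVneq i j.
    rewrite even_deg_diag mul0r big1 // => k _; rewrite big1 // => l _.
    by rewrite even_tri_diag mul0r.
  rewrite -sum_odd_tri // /even_deg mulr_suml; apply: eq_bigr => k _.
  by rewrite mulr_sumr.
have : 0 <= \sum_i \sum_j (h0 * even_deg i j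
    + h1 * (even_deg i j ^+ 2 - even_deg i j)
    - (h1 - h2) / 2 * (even_deg i j * (N%:R - 2 - even_deg i j))
    + (h1 - h2) / 2 * (even_deg i j * (N%:R - 2 - even_deg i j) - 2 * mixed_deg i j)).
  apply: sumr_ge0 => i _; apply: sumr_ge0 => j _.
  have [->|/H] := eqVneq i j.
    by rewrite even_deg_diag mixed_deg_diag expr0n /= !(mul0r, mulr0, subr0, addr0).
  by congr (0 <= _); field.
move=> /le_trans; apply; rewrite le_eqVlt; apply/orP; left; apply/eqP.
transitivity (\sum_i \sum_j ((h0 - h1 - (h1 - h2) / 2 * (N%:R - 2)) * even_deg i j
   + (3 * h1 - h2) / 2 * even_deg i j ^+ 2)
   + (h1 - h2) / 2 * (\sum_i \sum_j even_deg i j * (N%:R - 2 - even_deg i j)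
      - 2 * \sum_i \sum_j mixed_deg i j)).
  rewrite mulr_sumr -sumrB mulr_sumr -big_split /=; apply: eq_bigr => i _.
  rewrite mulr_sumr -sumrB mulr_sumr -big_split /=; apply: eq_bigr => j _.
  by field.
rewrite mixE subrr mulr0 addr0 !mulr_sumr -big_split; apply: eq_bigr => i _ /=.
by rewrite big_split /= !mulr_sumr.
Qed.

End Averaging.

Section CubicEdge.
Variables (R : realFieldType) (N d : nat) (s : 'I_N -> 'I_N -> R).
Variables (alpha : R) (V : 'M[R]_(N, d)).
Hypothesis sS : signing s.
Hypothesis al0 : 0 < alpha.
Hypothesis al1 : alpha < 1.
Hypothesis VV : forall k l, (V *m V^T) k l = (k == l)%:R + alpha * s k l.
Hypothesis d0 : (0 < d)%N.

(** This is [cubic_kernel_ge0] for the projections on the complement of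
    [v_i] and [v_j] of the lines [k] with [ijk] even, each oriented to have
    positive inner product with [v_i].  The projections have squared norm [rho],
    and the inner product of two of them is [u1] or [u2] according as [ikl] is
    even or odd. *)
Lemma cubic_edge_ineq (i j : 'I_N) (rho : R := 1 - 2 * alpha ^+ 2 / (1 + alpha))
   (u1 : R := alpha - 2 * alpha ^+ 2 / (1 + alpha))
   (u2 : R := - alpha - 2 * alpha ^+ 2 / (1 + alpha))
   (h := fun u : R => u ^+ 3 - 3 / d%:R * rho ^+ 2 * u) :
  i != j ->
  0 <= h rho * even_deg s i j + h u1 * (even_deg s i j ^+ 2 - even_deg s i j)
         - (h u1 - h u2) * mixed_deg s i j.
Proof.
move=> ij.
have sij : s i j ^+ 2 = 1 by rewrite (sS.2) ij.
have t1 : 1 - (alpha * s i j) ^+ 2 != 0.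
  by rewrite exprMn sij mulr1 subr_eq0 eq_sym lt_eqF // expr_lt1 // ltW.
have rowV k l : row k V *m (row l V)^T = ((k == l)%:R + alpha * s k l)%:M.
  rewrite -VV; apply/matrixP => x y; rewrite !ord1 !mxE mulr1n.
  by apply: eq_bigr => a _; rewrite !mxE.
have rowii k : row k V *m (row k V)^T = 1%:M.
  by rewrite rowV eqxx (signing_diag sS) mulr0 addr0.
have rowij : row i V *m (row j V)^T = (alpha * s i j)%:M.
  by rewrite rowV (negbTE ij) add0r.
(* [P] and [G] are introduced without a body, so that [mxE] stops at their
   entries. *)
have [P [Psym Pidem Ptr PE]] : exists P : 'M[R]_d, [/\ P^T = P, P *m P = P,
    \tr P = d%:R - 2 & P = compl_proj (row i V) (row j V) (alpha * s i j)].
  exists (compl_proj (row i V) (row j V) (alpha * s i j)); split => //.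
  - exact: compl_proj_sym.
  - exact: compl_proj_idem.
  - exact: mxtrace_compl_proj.
have [G GE] : exists G, G = V *m V^T by exists (V *m V^T).
(* The inner products of the projections, computed from the Gram matrix. *)
pose ip k l := G k l - (1 - alpha ^+ 2)^-1 * (G k i * G i l + G k j * G j l
   - alpha * s i j * (G k i * G j l + G k j * G i l)).
have ipE k l : ip k l = \sum_a (V *m P) k a * (V *m P) l a.
  transitivity ((V *m P *m (V *m P)^T) k l); last first.
    by rewrite mxE; apply: eq_bigr => a _; rewrite [X in _ * X]mxE.
  rewrite trmx_mul Psym mulmxA -(mulmxA V) Pidem.
  have outer x y : (V *m ((row x V)^T *m row y V) *m V^T) k l = G k x * G y l.
    rewrite mulmxA -(mulmxA _ _ V^T) mxE big_ord1; congr (_ * _).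
      by rewrite GE !mxE; apply: eq_bigr => a _; rewrite !mxE.
    by rewrite GE !mxE; apply: eq_bigr => a _; rewrite !mxE.
  rewrite PE /compl_proj mulmxBr mulmx1 mulmxBl -scalemxAr -scalemxAl mulmxBr mulmxBl.
  rewrite mulmxDr mulmxDl -scalemxAr -scalemxAl mulmxDr mulmxDl.
  rewrite /ip -GE; move: (outer i i) (outer j j) (outer i j) (outer j i).
  do 4 (move: (_ *m _ *m V^T) => ?).
  by rewrite !mxE exprMn sij mulr1 => -> -> -> ->.
have n2 : 0 < d%:R - 2 + 2 :> R by rewrite subrK ltr0n.
have ker := @cubic_kernel_ge0 R _ _ (fun a b => P a b) (d%:R - 2)
   (fun k a => (V *m P) k a) (fun k => even_tri s i j k * s i k) ip _ _ _ n2 _ ipE.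
have PsymE a b : P a b = P b a by rewrite -[in LHS]Psym mxE.
have {}ker : 0 <= \sum_k \sum_l even_tri s i j k * s i k * (even_tri s i j l * s i l) *
    (ip k l ^+ 3 - 3 / (d%:R - 2 + 2) * (ip k k * ip l l * ip k l)).
  apply: ker => [a b|a e||k a].
  - exact: PsymE.
  - by rewrite -[in RHS]Pidem mxE.
  - by rewrite -Ptr.
  - rewrite -[in RHS]Pidem mulmxA mxE; apply: eq_bigr => b _.
    by rewrite PsymE mulrC.
move: ker => /le_trans; apply; rewrite le_eqVlt; apply/orP; left; apply/eqP.
pose c := 2 * alpha ^+ 2 / (1 + alpha).
have s_sqr k : k != i -> s i k ^+ 2 = 1 by move=> ki; rewrite (sS.2) eq_sym ki.
(* The lines which occur in the sum satisfy [s k j = s i j * s k i], which makes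
   their inner products with [v_i] and [v_j] agree up to the sign [s i j]. *)
have evenP k : even_tri s i j k = 0 \/
    [/\ even_tri s i j k = 1, k != i, k != j & s k j = s i j * s i k].
  have := tri_sqr sS i j k.
  case E : (_ && _) => /eqP; last first.
    by rewrite sqrf_eq0 /even_tri => /eqP ->; left; field.
  move/andP: E => [/andP[_ jk] ki]; rewrite sqrf_eq1 => /orP[] /eqP triE; last first.
    by left; rewrite /even_tri triE; field.
  right; split => //; [by rewrite /even_tri triE; field | by rewrite eq_sym |].
  rewrite -[RHS]mul1r -triE /tri -[LHS]mul1r -[LHS]mul1r -{1}sij -(s_sqr k ki).
  by rewrite !(sS.1 k) (sS.1 j k); ring.
have a1 : 1 + alpha != 0 by rewrite gt_eqF // addr_gt0.
have a2 : 1 - alpha ^+ 2 != 0.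
  by rewrite subr_eq0 eq_sym lt_eqF // expr_lt1 // ltW.
have ip_even k l : k != i -> k != j -> s k j = s i j * s i k ->
    l != i -> l != j -> s l j = s i j * s i l ->
    ip k l = (k == l)%:R + alpha * s k l - c * (s i k * s i l).
  move=> ki kj skj li lj slj.
  rewrite /ip GE !VV (negbTE ki) (negbTE kj) !(eq_sym _ l) (negbTE li) (negbTE lj).
  rewrite !(sS.1 _ l) slj (sS.1 l i) skj (sS.1 k i) !add0r.
  have -> : alpha * s i k * (alpha * s i l)
      + alpha * (s i j * s i k) * (alpha * (s i j * s i l))
      - alpha * s i j * (alpha * s i k * (alpha * (s i j * s i l))
                         + alpha * (s i j * s i k) * (alpha * s i l))
    = alpha ^+ 2 * s i k * s i l * (1 + s i j ^+ 2 - 2 * alpha * s i j ^+ 2) by ring.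
  by rewrite sij /c; field; rewrite a1 a2.
transitivity (\sum_k \sum_l (even_tri s i j k * even_tri s i j l *
    ((h rho - h u1) * (k == l)%:R + h u1 - (h u1 - h u2) * odd_tri s i k l))).
  apply: eq_bigr => k _; apply: eq_bigr => l _; rewrite subrK.
  have [->|[ek ki kj skj]] := evenP k; first by rewrite !mul0r.
  have [->|[el li lj slj]] := evenP l; first by rewrite !(mul0r, mulr0).
  have ipkk x : x != i -> x != j -> s x j = s i j * s i x -> ip x x = rho.
    move=> xi xj sx; rewrite ip_even // eqxx (signing_diag sS) -expr2 s_sqr //.
    by rewrite /rho /c /=; ring.
  rewrite ek el !mul1r (ipkk k) // (ipkk l) //.
  have [<-|kl] := eqVneq k l.
    rewrite -expr2 s_sqr // (ipkk k) // /odd_tri /tri (signing_diag sS) /h /=.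
    by field; rewrite pnatr_eq0 -lt0n d0.
  have xy : (s i k * s i l) ^+ 2 = 1 by rewrite exprMn !s_sqr // mulr1.
  have ipkl : ip k l = s i k * s i l * (alpha * tri s i k l - c).
    rewrite ip_even // (negbTE kl) add0r /tri (sS.1 l i).
    transitivity ((s i k * s i l) ^+ 2 * (alpha * s k l) - c * (s i k * s i l)).
      by rewrite xy mul1r.
    by ring.
  have -> : s i k * s i l * (ip k l ^+ 3 - 3 / d%:R * (rho * rho * ip k l))
      = h (alpha * tri s i k l - c).
    rewrite ipkl /h.
    transitivity ((s i k * s i l) ^+ 2 * ((s i k * s i l) ^+ 2 * (alpha * tri s i k l - c) ^+ 3
      - 3 / d%:R * rho ^+ 2 * (alpha * tri s i k l - c))); first by ring.
    by rewrite xy !mul1r.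
  have : (i != k) && (k != l) && (l != i) by rewrite eq_sym ki kl li.
  rewrite mulr0 add0r /odd_tri; case: triP => // _.
    by rewrite mulr1 -/u1; ring.
  by rewrite mulrN1 -/u2; field.
transitivity (\sum_k ((h rho - h u1) * even_tri s i j k ^+ 2
     + h u1 * (even_tri s i j k * even_deg s i j)
     - (h u1 - h u2) * \sum_l even_tri s i j k * even_tri s i j l * odd_tri s i k l)).
  apply: eq_bigr => k _; rewrite /even_deg !mulr_sumr.
  rewrite -(sum_delta k (fun l => (h rho - h u1) * (even_tri s i j k * even_tri s i j l))).
  rewrite -sumrN -!big_split /=; apply: eq_bigr => l _.
  by rewrite (eq_sym l); ring.
rewrite sumrB big_split /= -!mulr_sumr -mulr_suml -/(even_deg s i j).
under eq_bigr do rewrite (even_tri_idem sS).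
by rewrite -/(even_deg s i j) -/(mixed_deg s i j); ring.
Qed.

End CubicEdge.

(** * Tightness of the frame *)

Section Tight.
Variables (R : realFieldType) (N d : nat) (s : 'I_N -> 'I_N -> R) (a : R).
Variable V : 'M[R]_(N, d).
Hypothesis sS : signing s.
Hypothesis a3 : 3 <= a.
Hypothesis d0 : (0 < d)%N.
Hypothesis dT : (a ^+ 3 + 9 * a + 6) * d%:R < 3 * a * ((a - 1) * (a + 2)) ^+ 2.
Hypothesis N2 : N%:R = (a ^+ 2 - 1) * (a ^+ 2 - 2) / 2.
Hypothesis VV : V *m V^T = 1%:M + a^-1 *: \matrix_(i, j) s i j.

Let a_gt0 : 0 < a. Proof. exact: lt_le_trans a3. Qed.

(** The number of even triangles on each edge when [G^2 = mu G]. *)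
Let p0 : R := (N%:R - 1 - a) * (a + 1) / (2 * a).

Lemma p0_gt0 : 0 < p0.
Proof.
have age3 := a3; have ag0 := a_gt0.
have A : 3 * a <= a ^+ 2 by rewrite expr2 ler_pM2r.
have H : 0 < N%:R - 1 - a.
  have : 0 <= (a ^+ 2 - 3 * a) * (a ^+ 2 - 3) by apply: mulr_ge0; lra.
  have : 0 <= a * (a ^+ 2 - 9) by apply: mulr_ge0; lra.
  by rewrite N2; lra.
by rewrite /p0 divr_gt0 ?mulr_gt0 //; lra.
Qed.

(** For this value of [N], the coefficient of the first moment in
    [sum_cubic_edge_ineq] is [- p0] times the coefficient [B] of the second
    moment; the bound on [d] says that [B] is negative. *)
Lemma sum_even_deg_sqr_le :
  \sum_i \sum_j even_deg s i j ^+ 2 <= p0 * \sum_i \sum_j even_deg s i j.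
Proof.
have age3 := a3; have ag0 := a_gt0.
have al0 : 0 < a^-1 by rewrite invr_gt0.
have al1 : a^-1 < 1 by rewrite invf_lt1 //; lra.
have VVE k l : (V *m V^T) k l = (k == l)%:R + a^-1 * s k l by rewrite VV !mxE.
have := sum_cubic_edge_ineq sS (cubic_edge_ineq sS al0 al1 VVE d0).
set S1 := \sum_i _; set S2 := \sum_i _.
set B := (_ / 2 in X in _ + X * _).
have dR : 0 < d%:R :> R by rewrite ltr0n.
set A := (X in X * S1); have -> : A = - p0 * B.
  rewrite /A /B /p0 N2; field.
  by rewrite !gt_eqF // ?addr_gt0.
have B0 : B < 0.
  have -> : B = 2 * ((a ^+ 3 + 9 * a + 6) * d%:R - 3 * a * ((a - 1) * (a + 2)) ^+ 2)
               / (d%:R * (a * (a + 1)) ^+ 3).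
    rewrite /B; field.
    by rewrite !gt_eqF // ?addr_gt0.
  rewrite pmulr_llt0 ?invr_gt0 ?mulr_gt0 ?exprn_gt0 ?mulr_gt0 ?addr_gt0 //.
  by rewrite pmulr_rlt0 // subr_lt0.
have -> : - p0 * B * S1 + B * S2 = B * (S2 - p0 * S1) by ring.
by rewrite nmulr_rge0 // subr_le0.
Qed.

Lemma sum_neq : \sum_(i < N) \sum_(j < N) (i != j)%:R = N%:R * (N%:R - 1) :> R.
Proof.
transitivity (\sum_(i < N) (N%:R - 1) : R); last first.
  by rewrite sumr_const card_ord mulr_natl.
apply: eq_bigr => i _.
transitivity (\sum_(j < N) (1 - (j == i)%:R * 1) : R).
  by apply: eq_bigr => j _; rewrite mulr1 eq_sym; case: eqP; rewrite ?subrr ?subr0.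
by rewrite sumrB sum_delta sumr_const card_ord.
Qed.

(** The sum of [(even_deg s i j - p0)^2] over the pairs of distinct indices is
    nonnegative. *)
Lemma sum_even_deg_le :
  \sum_i \sum_j even_deg s i j <= p0 * (N%:R * (N%:R - 1)).
Proof.
have H : 0 <= \sum_i \sum_j (even_deg s i j - p0 * (i != j)%:R) ^+ 2.
  by do 2 (apply: sumr_ge0 => ? _); apply: sqr_ge0.
have E : \sum_i \sum_j (even_deg s i j - p0 * (i != j)%:R) ^+ 2
   = \sum_i \sum_j even_deg s i j ^+ 2 - 2 * p0 * \sum_i \sum_j even_deg s i j
     + p0 ^+ 2 * (N%:R * (N%:R - 1)).
  rewrite -sum_neq !mulr_sumr -sumrB -big_split; apply: eq_bigr => i _ /=.
  rewrite !mulr_sumr -sumrB -big_split; apply: eq_bigr => j _ /=.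
  case: eqVneq => [->|_] /=; last by ring.
  by rewrite (even_deg_diag sS); ring.
have := sum_even_deg_sqr_le; move: H; rewrite E => H1 H2.
rewrite -(ler_pM2l p0_gt0); lra.
Qed.

Let S := \matrix_(i, j) s i j.

Lemma mxtrace_S : \tr S = 0.
Proof. by rewrite /mxtrace big1 // => i _; rewrite mxE (signing_diag sS). Qed.

Lemma mxtrace_S2 : \tr (S *m S) = N%:R * (N%:R - 1).
Proof.
rewrite -sum_neq; apply: eq_bigr => i _; rewrite mxE; apply: eq_bigr => j _.
by rewrite !mxE (sS.1 j) -expr2 (sS.2).
Qed.

Lemma mxtrace_S3 :
  \tr (S *m S *m S) = 2 * \sum_i \sum_j even_deg s i j
                        - N%:R * (N%:R - 1) * (N%:R - 2).
Proof.
rewrite -sum_neq mulr_sumr mulr_suml -sumrB; apply: eq_bigr => i _.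
transitivity (\sum_j \sum_k tri s i j k).
  rewrite mxE exchange_big /=.
  apply: eq_bigr => k _; rewrite !mxE mulr_suml.
  by apply: eq_bigr => j _; rewrite !mxE.
rewrite mulr_sumr mulr_suml -sumrB; apply: eq_bigr => j _.
have [<-|ij] := eqVneq i j.
  rewrite (even_deg_diag sS) mulr0 mul0r subr0 big1 // => k _.
  by rewrite /tri (signing_diag sS) !mul0r.
transitivity (\sum_k even_tri s i j k - \sum_k odd_tri s i j k).
  by rewrite -sumrB; apply: eq_bigr => k _; rewrite /even_tri /odd_tri; field.
by rewrite sum_odd_tri // -/(even_deg s i j) /=; ring.
Qed.

(** The squared norm of the difference [W] of the two sides is an increasing linear
    function of the number of even triangles; by [sum_even_deg_le] it is at most
    its value when every edge lies in [p0] of them, which is 0. *)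
Lemma tight_frame : V *m V^T *m V = ((a ^+ 2 - 1) / 2) *: V.
Proof.
pose mu := (a ^+ 2 - 1) / 2.
pose W := V *m V^T *m V - mu *: V.
suff W0 : W = 0 by apply/eqP; rewrite -subr_eq0 -/W W0.
have ag0 := a_gt0.
have WE : W = ((1 - mu)%:M + a^-1 *: S) *m V.
  rewrite /W VV !mulmxDl mul1mx mul_scalar_mx scalerBl scale1r.
  by rewrite addrAC.
have St : S^T = S by apply/matrixP => i j; rewrite !mxE (sS.1).
have trE (x c : R) : \tr ((x%:M + c *: S) *m (1%:M + c *: S) *m (x%:M + c *: S))
   = x ^+ 2 * N%:R + (1 + 2 * x) * c ^+ 2 * \tr (S *m S) + c ^+ 3 * \tr (S *m S *m S).
  rewrite !mulmxDl !mulmxDr !mulmxDl.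
  rewrite -?(scalemxAl, scalemxAr) !(mulmx1, mul1mx, mul_scalar_mx, mul_mx_scalar).
  rewrite !(mxtraceD, mxtraceZ) ?mxtrace_scalar ?mxtrace1 ?mxtrace_S.
  by rewrite -scalemxAl mxtraceZ -mulr_natr; ring.
have trW : \tr (W *m W^T) <= 0.
  have -> : W *m W^T = ((1 - mu)%:M + a^-1 *: S) *m (1%:M + a^-1 *: S)
                       *m ((1 - mu)%:M + a^-1 *: S).
    rewrite WE trmx_mul linearD /= linearZ /= tr_scalar_mx St -VV.
    by rewrite !mulmxA.
  have S1_le := sum_even_deg_le.
  rewrite trE mxtrace_S2 mxtrace_S3.
  apply: (@le_trans _ _ ((1 - mu) ^+ 2 * N%:R
     + (1 + 2 * (1 - mu)) * a^-1 ^+ 2 * (N%:R * (N%:R - 1))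
     + a^-1 ^+ 3 * (2 * (p0 * (N%:R * (N%:R - 1))) - N%:R * (N%:R - 1) * (N%:R - 2)))).
    by rewrite lerD2l ler_pM2l ?exprn_gt0 ?invr_gt0 // lerB // ler_pM2l.
  rewrite le_eqVlt; apply/orP; left; apply/eqP.
  by rewrite /p0 /mu N2; field; rewrite gt_eqF.
have trWE : \tr (W *m W^T) = \sum_i \sum_j W i j ^+ 2.
  by apply: eq_bigr => i _; rewrite mxE; apply: eq_bigr => j _; rewrite [W^T _ _]mxE -expr2.
have trW0 : \sum_i \sum_j W i j ^+ 2 = 0.
  apply/eqP; rewrite eq_le -{1}trWE trW /=.
  by do 2 (apply: sumr_ge0 => ? _); apply: sqr_ge0.
apply/matrixP => i j; rewrite [RHS]mxE; apply/eqP; rewrite -sqrf_eq0; apply/eqP.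
have rowge0 k : 0 <= \sum_l W k l ^+ 2 by apply: sumr_ge0 => ? _; apply: sqr_ge0.
have rowi : \sum_l W i l ^+ 2 = 0 by apply: psumr_eq0P (fun k _ => rowge0 k) trW0 _ _.
by apply: psumr_eq0P (fun l _ => sqr_ge0 (W i l)) rowi _ _.
Qed.

End Tight.

(** * Dimension of the span *)

(** With [B] a basis of the row space of [V] and [V = C *m B], the hypothesis
    says that [B *m V^T *m C] is the scalar matrix [mu] of size the dimension; its
    trace is that of [V *m V^T]. *)
Lemma dim_span_rows (R : fieldType) (N d : nat) (V : 'M[R]_(N, d)) (mu : R) :
  V *m V^T *m V = mu *: V ->
  \tr (V *m V^T) = mu * (\dim <<[tuple row i V | i < N]>>)%:R.
Proof.
move=> VVV; set X := [tuple _ | _ < _]; set U := <<X>>%VS.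
have XE (i : 'I_N) : X`_i = row i V by rewrite -tnth_nth tnth_mktuple.
pose B := \matrix_(k < \dim U) (vbasis U)`_k.
pose C := \matrix_(i < N, k < \dim U) coord (vbasis U) k (row i V).
pose C' := \matrix_(k < \dim U, i < N) coord X i (vbasis U)`_k.
have VE : V = C *m B.
  apply/row_matrixP => i; rewrite row_mul {1}(coord_vbasis (_ : row i V \in U)).
    rewrite mulmx_sum_row; apply: eq_bigr => k _.
    by rewrite !mxE rowK.
  by apply: memv_span; rewrite -XE mem_nth // size_tuple.
have BE : B = C' *m V.
  apply/row_matrixP => k; rewrite rowK row_mul.
  rewrite {1}(coord_span (_ : (vbasis U)`_k \in <<X>>%VS)).
    rewrite mulmx_sum_row; apply: eq_bigr => i _.
    by rewrite !mxE XE.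
  by apply: vbasis_mem; rewrite mem_nth // size_tuple.
have Bfree : row_free B.
  apply: inj_row_free => v vB0; apply/rowP => k; rewrite mxE.
  have /freeP := basis_free (vbasisP U); apply.
  by rewrite -[RHS]vB0 mulmx_sum_row; apply: eq_bigr => l _; rewrite rowK.
have BVC : B *m V^T *m C = mu%:M.
  apply: (row_free_inj Bfree) => /=.
  rewrite -(mulmxA _ C B) -VE {1}BE -!mulmxA (mulmxA V) VVV -scalemxAr -BE.
  by rewrite mul_scalar_mx.
by rewrite {1}VE -mulmxA mxtrace_mulC BVC mxtrace_scalar mulr_natr.
Qed.

(** * Unit vectors on lines *)

Definition direction (R : realType) (d : nat) (l : {vspace 'rV[R]_d}) : 'rV[R]_d :=
  (Num.sqrt (dot (vpick l) (vpick l)))^-1 *: vpick l.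

Lemma dotZ (R : realType) (d : nat) (c : R) (u : 'rV[R]_d) :
  dot (c *: u) (c *: u) = c ^+ 2 * dot u u.
Proof. by rewrite /dot mulr_sumr; apply: eq_bigr => i _; rewrite !mxE; ring. Qed.

Lemma dotC (R : realType) (d : nat) (u v : 'rV[R]_d) : dot u v = dot v u.
Proof. by apply: eq_bigr => i _; rewrite mulrC. Qed.

Lemma dot_gt0 (R : realType) (d : nat) (u : 'rV[R]_d) : u != 0 -> 0 < dot u u.
Proof.
move=> u0; have sq_ge0 i : 0 <= u 0 i * u 0 i by rewrite -expr2 sqr_ge0.
rewrite lt_def sumr_ge0 // andbT; apply: contra u0 => /eqP /psumr_eq0P u0.
apply/eqP/rowP => i; rewrite mxE; apply/eqP; rewrite -sqrf_eq0 expr2.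
by rewrite u0.
Qed.

Lemma direction_mem (R : realType) (d : nat) (l : {vspace 'rV[R]_d}) : direction l \in l.
Proof. by rewrite memvZ // memv_pick. Qed.

Lemma direction_unit (R : realType) (d : nat) (l : {vspace 'rV[R]_d}) :
  is_line l -> unit_vector (direction l).
Proof.
move=> l1; have p0 : 0 < dot (vpick l) (vpick l).
  by apply: dot_gt0; rewrite vpick0 -dimv_eq0 l1.
by rewrite /unit_vector dotZ exprVn sqr_sqrtr ?ltW // mulVf // gt_eqF.
Qed.

Lemma line_span (R : realType) (d : nat) (l : {vspace 'rV[R]_d}) :
  is_line l -> l = <[direction l]>%VS.
Proof.
move=> l1; apply/eqP; rewrite eq_sym eqEdim -memvE direction_mem /= l1 dim_vline.
case: eqP (direction_unit l1) => [->|//].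
rewrite /unit_vector /dot big1 => [/eqP|i _]; last by rewrite mxE mul0r.
by rewrite eq_sym oner_eq0.
Qed.

(** * Equiangular lines of extremal cardinality *)

Lemma card_natr (R : realFieldType) (a : nat) : (3 <= a)%N -> odd a ->
  (((a ^ 2 - 1) * (a ^ 2 - 2))./2)%:R
  = (a%:R ^+ 2 - 1) * (a%:R ^+ 2 - 2) / 2 :> R.
Proof.
move=> a3 a_odd.
have a9 : (9 <= a ^ 2)%N by rewrite (@leq_exp2r 3 a 2).
apply: (canRL (mulfK _)); first by rewrite pnatr_eq0.
rewrite -natrX -(natrB _ (_ : 1 <= _)%N) ?(leq_trans _ a9) //.
rewrite -(natrB _ (_ : 2 <= _)%N) ?(leq_trans _ a9) // -!natrM; congr _%:R.
by rewrite muln2 even_halfK // oddM oddB ?(leq_trans _ a9) // oddX a_odd.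
Qed.

Theorem theorem1p4 (R : realType) (a d : nat) (D : R) :
  (3 <= a)%N -> odd a -> (0 < d)%N -> is_D4 a D -> d%:R < D ->
  forall L : {fset {vspace 'rV[R]_d}},
    equiangular L -> has_inner_product L (1 / a%:R) ->
    #|` L| = ((a ^ 2 - 1) * (a ^ 2 - 2))./2 ->
    exists U : {vspace 'rV[R]_d},
      \dim U = (a ^ 2 - 2)%N /\ (forall l, l \in L -> (l <= U)%VS).
Proof.
move=> a3 a_odd d0 [gD _] dD L [L_line _] L_ip cardL.
pose N := #|` L|; pose l (i : 'I_N) := nth 0%VS (enum_fset L) i.
have lL i : l i \in L by apply: mem_nth; rewrite -/N.
have l_neq i j : i != j -> l i != l j.
  by move=> ij; rewrite nth_uniq ?fset_uniq.
pose u i := direction (l i).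
pose V : 'M[R]_(N, d) := \matrix_i u i.
pose s i j : R := if i == j then 0 else a%:R * dot (u i) (u j).
have aR3 : 3 <= a%:R :> R by rewrite ler_nat.
have aR0 : 0 < a%:R :> R by apply: lt_le_trans aR3.
have sS : signing s.
  split=> i j; rewrite /s; first by rewrite eq_sym dotC.
  case: eqVneq => [_|ij]; first by rewrite expr0n.
  have u_unit x : unit_vector (u x) by exact/direction_unit/L_line.
  have [->|->] := L_ip _ _ (lL i) (lL j) (l_neq _ _ ij) _ _
     (direction_mem _) (direction_mem _) (u_unit i) (u_unit j).
    by rewrite mulrA mulr1 mulfV ?expr1n // gt_eqF.
  by rewrite mulrN mulrA mulr1 mulfV ?sqrrN ?expr1n // gt_eqF.
have VV : V *m V^T = 1%:M + a%:R^-1 *: \matrix_(i, j) s i j.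
  apply/matrixP => i j; rewrite !mxE.
  transitivity (dot (u i) (u j)).
    by apply: eq_bigr => k _; rewrite !mxE.
  rewrite /s; case: eqVneq => [->|ij] /=.
    by rewrite mulr0 addr0; apply: direction_unit; apply: L_line.
  by rewrite add0r mulKf // gt_eqF.
have NR : N%:R = (a%:R ^+ 2 - 1) * (a%:R ^+ 2 - 2) / 2 :> R.
  by rewrite /N cardL card_natr.
have dT : (a%:R ^+ 3 + 9 * a%:R + 6) * d%:R < 3 * a%:R * ((a%:R - 1) * (a%:R + 2)) ^+ 2 :> R.
  apply: lt_le_trans (D4_le aR3 gD).
  by rewrite ltr_pM2l // !addr_gt0 ?mulr_gt0 ?exprn_gt0.
have frame := tight_frame sS aR3 d0 dT NR VV.
exists <<[tuple row i V | i < N]>>%VS; split.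
  have := dim_span_rows frame.
  rewrite VV mxtraceD mxtraceZ mxtrace1 (mxtrace_S sS) mulr0 addr0 NR mulrAC.
  have a9 : (9 <= a ^ 2)%N by rewrite (@leq_exp2r 3 a 2).
  have mu0 : (a%:R ^+ 2 - 1) / 2 != 0 :> R.
    rewrite -natrX -(natrB _ (_ : 1 <= _)%N) ?(leq_trans _ a9) //.
    by apply: mulf_neq0; rewrite ?invr_eq0 pnatr_eq0 ?subn_eq0 -?ltnNge ?(leq_trans _ a9).
  move/(mulfI mu0); rewrite -natrX -(natrB _ (_ : 2 <= _)%N) ?(leq_trans _ a9) //.
  by move/eqP; rewrite eqr_nat => /eqP.
move=> l' l'L.
have iN : (index l' (enum_fset L) < N)%N by rewrite index_mem.
have -> : l' = l (Ordinal iN) by rewrite /l nth_index.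
rewrite (line_span (L_line _ (lL _))) -memvE -/(u _).
have -> : u (Ordinal iN) = row (Ordinal iN) V by rewrite rowK.
by apply: memv_span; apply/tnthP; exists (Ordinal iN); rewrite tnth_mktuple.
Qed.
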